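(* The set of $q\in(0,1)$ for which there exists exactly one $S$-gap shift with entropy $q$ has Hausdorff dimension $1$.
   Context: For a nonempty set $S\subseteq\{0,1,2,\dots\}$, the $S$-gap shift $X(S)\subseteq\{0,1\}^{\mathbb{Z}}$ is the set of bi-infinite binary sequences in which the number of consecutive zeros between ones is always an element of $S$. The entropy of a shift $X$ is $h(X)=\lim_n\frac1n\log|\mathcal{B}_n(X)|$, where $\mathcal{B}_n(X)$ is the set of words of length $n$ occurring in points of $X$ and $\log$ is to base $2$. *)

(* Defs.v *)
From HB Require Import structures.
From mathcomp Require Import all_boot all_order all_algebra.
From mathcomp Require Import all_classical all_reals all_analysis.
Set Implicit Arguments. Unset Strict Implicit. Unset Printing Implicit Defensive.
Import Order.TTheory GRing.Theory Num.Theory.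
Import numFieldNormedType.Exports.
Local Open Scope classical_set_scope.
Local Open Scope ring_scope.

Definition binseq := int -> bool.

Definition gap_shift (S : set nat) : set binseq :=
  [set x : binseq | forall (i j : int), (i < j)%R -> x i = true -> x j = true ->
      (forall k : int, (i < k)%R -> (k < j)%R -> x k = false) ->
      S (absz (j - i - 1)%R)].

Definition occurs_in (X : set binseq) (n : nat) (w : {ffun 'I_n -> bool}) : Prop :=
  exists2 x, X x & exists k : int, forall i : 'I_n, w i = x (k + (i : nat)%:Z)%R.

Definition blocks (X : set binseq) (n : nat) : {set {ffun 'I_n -> bool}} :=
  [set w | `[< occurs_in X w >]].

Definition entropy {R : realType} (X : set binseq) : R :=
  limn (fun n : nat => ln (#|blocks X n|%:R : R) / (n%:R * ln 2)).

Definition ediam {R : realType} (A : set R) : \bar R :=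
  ereal_sup [set (`|x - y|)%:E | x in A & y in A].

Definition hpow {R : realType} (s : R) (A : set R) : \bar R :=
  if `[< A = set0 >] then 0%E else ((fine (ediam A)) `^ s)%:E.

Definition hausdorff_pre {R : realType} (s delta : R) (E : set R) : \bar R :=
  ereal_inf [set (\sum_(0 <= i <oo) hpow s (F i))%E | F in
     [set F : nat -> set R | E `<=` \bigcup_i F i /\
                             forall i, (ediam (F i) <= delta%:E)%E]].

Definition hausdorff_measure {R : realType} (s : R) (E : set R) : \bar R :=
  ereal_sup [set hausdorff_pre s delta E | delta in [set d : R | 0 < d]].

Definition hausdorff_dim {R : realType} (E : set R) : \bar R :=
  ereal_inf [set s%:E | s in [set s : R | 0 <= s /\ hausdorff_measure s E = 0%E]].

(* Main.v *)
Require Import Defs.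
From HB Require Import structures.
From mathcomp Require Import all_boot all_order all_algebra.
From mathcomp Require Import all_classical all_reals all_analysis.
From mathcomp Require Import zify ring lra.
Set Implicit Arguments.
Unset Strict Implicit.
Unset Printing Implicit Defensive.
Import Order.TTheory GRing.Theory Num.Theory.
Import numFieldNormedType.Exports.
Local Open Scope classical_set_scope.
Local Open Scope ring_scope.

(** Put [t = 2^-q] and write [e] for the indicator function of [S].  Counting
    words by the position of their ones gives a renewal recursion, from which the
    entropy of the [S]-gap shift is [- log2 t] with [t] the largest point of
    [0, 1] where the power series [\sum_i e_i t^(i+1)] is at most [1]; when
    [t < 1] the value there is [1].  Hence [q] in (0, 1) is the entropy of exactly
    one gap shift as soon as [1] has a unique expansion in base [2^q] with digits
    0 and 1.

    If [e] starts with [N + 2] ones and afterwards every window of length [N]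
    contains both digits, then [2 t - 1 <= t^(N+3)], and a tail having a zero among
    its first [N] digits has value at most [1 - t^N / 9].  This proves
    uniqueness of the expansion, and also shows that two such sequences which first
    differ at place [n] have values of [t] at least [c 2^-n] apart.  Filling the
    free places of the blocks [* ... * 0 1] of length [K + 2] with the binary digits
    of a number [y] in [0, 1[ gives a map [y |-> q] whose inverse is Hölder of
    every exponent [s <= K / (K + 2)], so the set of such [q] has positive
    [s]-dimensional Hausdorff measure. *)

(** * Power series with binary digits *)

Section DigitSeries.
Variable R : realType.
Implicit Types (e : nat -> bool) (t u : R).

Definition digit_term e t : R^nat := fun i => (e i)%:R * t ^+ i.+1.
Definition digit_series e t : R := limn (series (digit_term e t)).

Lemma digit_term_ge0 e t i : 0 <= t -> 0 <= digit_term e t i.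
Proof. by move=> t0; rewrite mulr_ge0 ?ler0n ?exprn_ge0. Qed.

Lemma is_cvg_digit_series e t : 0 <= t < 1 -> cvgn (series (digit_term e t)).
Proof.
move=> /andP[t0 t1].
apply: (@series_le_cvg _ _ (geometric t t)).
- by move=> i; apply: digit_term_ge0.
- by move=> i; rewrite /geometric /= mulr_ge0 ?exprn_ge0.
- move=> i; rewrite /digit_term /geometric /= -exprS.
  by case: (e i); rewrite ?mul1r ?mul0r ?exprn_ge0.
- by apply: is_cvg_geometric_series; rewrite ger0_norm.
Qed.

Lemma digit_series_ge_partial e t n : 0 <= t < 1 ->
  series (digit_term e t) n <= digit_series e t.
Proof.
move=> t01; apply: nondecreasing_cvgn_le; last exact: is_cvg_digit_series.
apply/nondecreasing_seqP => k.
rewrite /series /= big_nat_recr //= lerDl digit_term_ge0 //.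
by case/andP: t01.
Qed.

Lemma digit_series_le e t (c : R) : 0 <= t < 1 ->
  (forall n, series (digit_term e t) n <= c) -> digit_series e t <= c.
Proof.
move=> t01 h; apply: limr_le; first exact: is_cvg_digit_series.
exact: nearW.
Qed.

Lemma digit_series_ge0 e t : 0 <= t < 1 -> 0 <= digit_series e t.
Proof.
move=> t01; apply: le_trans (digit_series_ge_partial e 0 t01).
by rewrite /series /= big_geq.
Qed.

(** Swapping the digits turns lower bounds for one series into upper bounds for the other. *)
Lemma digit_seriesC e t : 0 <= t < 1 ->
  digit_series e t + digit_series (fun i => ~~ e i) t = t / (1 - t).
Proof.
move=> t01; rewrite /digit_series -limD; [|exact: is_cvg_digit_series..].
case/andP: t01 => t0 t1.
have -> : series (digit_term e t) + series (digit_term (fun i => ~~ e i) t)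
   = series (geometric t t).
  apply/funext => n; rewrite /= /series /= fctE -big_split /=; apply: eq_bigr => i _.
  rewrite /digit_term /geometric /= -exprS.
  by case: (e i); rewrite ?mul1r ?mul0r ?addr0 ?add0r.
by apply/cvg_lim => //; apply: cvg_geometric_series; rewrite ger0_norm.
Qed.

Lemma digit_series_le_geometric e t : 0 <= t < 1 -> digit_series e t <= t / (1 - t).
Proof.
by move=> t01; rewrite -(digit_seriesC e t01) lerDl digit_series_ge0.
Qed.

Lemma digit_series_split e t n : 0 <= t < 1 ->
  digit_series e t = series (digit_term e t) n + t ^+ n * digit_series (fun i => e (n + i)%N) t.
Proof.
move=> t01; rewrite /digit_series.
set f := fun i => e (n + i)%N.
have cf := @is_cvg_digit_series f t t01.
apply/cvg_lim => //.
rewrite -(cvg_shiftn n) /=.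
have -> : (fun k => series (digit_term e t) (k + n)%N) =
  (fun k => series (digit_term e t) n + t ^+ n * series (digit_term f t) k).
  apply/funext => k; rewrite /series /= (@big_cat_nat _ _ _ n) //= ?leq_addl //.
  congr (_ + _).
  rewrite -{1}[n]add0n big_addn addnK big_distrr /=; apply: eq_bigr => i _.
  by rewrite /digit_term /f addnC mulrCA -exprD addnS.
by apply: cvgD; [exact: cvg_cst|apply: cvgM => //; exact: cvg_cst].
Qed.

Lemma digit_series_le_of_zero e t m : 0 <= t < 1 -> ~~ e m ->
  digit_series e t <= t / (1 - t) - t ^+ m.+1.
Proof.
move=> t01 em; rewrite -(digit_seriesC e t01) -addrA lerDl subr_ge0.
apply: le_trans (digit_series_ge_partial _ m.+1 t01).
rewrite /series /= big_nat_recr //= {2}/digit_term em mul1r lerDr.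
by apply: sumr_ge0 => i _; apply: digit_term_ge0; case/andP: t01.
Qed.

Lemma digit_term_mono e t u i : 0 <= u <= t -> digit_term e u i <= digit_term e t i.
Proof.
case/andP => u0 ut; rewrite ler_wpM2l // lerXn2r // nnegrE //.
exact: le_trans ut.
Qed.

Lemma digit_series_mono e t u : 0 <= u <= t -> t < 1 ->
  digit_series e u <= digit_series e t.
Proof.
move=> ut t1; case/andP: (ut) => u0 u_le_t.
have t01 : 0 <= t < 1 by rewrite t1 (le_trans u0).
have u01 : 0 <= u < 1 by rewrite u0 (le_lt_trans u_le_t).
apply: digit_series_le => // n.
apply: le_trans (digit_series_ge_partial e n t01).
by apply: ler_sum => i _; apply: digit_term_mono.
Qed.

(* Monotonicity of the complementary series bounds the increments of
   [digit_series e] by those of the geometric series. *)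
Lemma digit_series_increment e t u : 0 <= u <= t -> t < 1 ->
  digit_series e t - digit_series e u <= (t - u) / ((1 - t) * (1 - u)).
Proof.
move=> ut t1; case/andP: (ut) => u0 u_le_t.
have t01 : 0 <= t < 1 by rewrite t1 (le_trans u0).
have u1 := le_lt_trans u_le_t t1.
have u01 : 0 <= u < 1 by rewrite u0 u1.
have := digit_series_mono (fun i => ~~ e i) ut t1.
have := digit_seriesC e t01; have := digit_seriesC e u01.
have -> : (t - u) / ((1 - t) * (1 - u)) = t / (1 - t) - u / (1 - u).
  by field; rewrite !subr_eq0 !gt_eqF.
lra.
Qed.

End DigitSeries.

(** * Counting the words of a gap shift *)

Section Counting.
Variable e : nat -> bool.

Local Open Scope nat_scope.

Definition gap_ok (st : option nat) := if st is Some d then e d else true.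

(* The state [st] is [Some d] when the last 1 read is followed by exactly [d]
   zeros, and [None] when no 1 has been read. *)
Fixpoint legal n (st : option nat) (x : nat -> bool) : bool :=
  if n is m.+1 then
    if x 0 then gap_ok st && legal m (Some 0) (fun i => x i.+1)
    else legal m (omap succn st) (fun i => x i.+1)
  else true.

Fixpoint legal_count n (st : option nat) : nat :=
  if n is m.+1 then gap_ok st * legal_count m (Some 0) + legal_count m (omap succn st)
  else 1.

Lemma eq_legal n st x y : (forall i, i < n -> x i = y i) -> legal n st x = legal n st y.
Proof.
elim: n st x y => [//|n IH] st x y xy /=.
have h i : i < n -> x i.+1 = y i.+1 by move=> ?; apply: xy.
by rewrite xy // (IH _ _ _ h) (IH (omap _ _) _ _ h).
Qed.

Lemma legalP n st (x : nat -> bool) : reflect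
  ((forall i j, i < j < n -> x i -> x j -> (forall k, i < k < j -> ~~ x k) -> e (j - i).-1) /\
   (forall j, j < n -> x j -> (forall k, k < j -> ~~ x k) -> gap_ok (omap (addn j) st)))
  (legal n st x).
Proof.
elim: n st x => [|n IH] st x /=.
  by apply: ReflectT; split => [i j /andP[]|].
case x0: (x 0).
  apply: (iffP andP) => [[ok /IH[h1 h2]]|[h1 h2]].
    split=> [[|i] [|j] //= ij xi xj z | [|j] // jn xj z].
    - have := h2 j ij xj (fun k kj => z k.+1 kj).
      by rewrite /= addn0.
    - by apply: (h1 i j) => // k kj; apply: z.
    - by case: (st) ok.
    - by move: (z 0 isT); rewrite x0.
  split; first by move: (h2 0 isT x0); case: (st) => //= d; apply.
  apply/IH; split=> [i j ij xi xj z|j jn xj z] /=.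
    apply: (h1 i.+1 j.+1) => // -[//|k] kj; exact: z.
  rewrite addn0; apply: (h1 0 j.+1) => // -[//|k] kj; exact: z.
apply: (iffP (IH _ _)) => [[h1 h2]|[h1 h2]].
  split=> [[|i] [|j] //= ij xi xj z | [|j] // jn xj z].
  - by rewrite xi in x0.
  - by apply: (h1 i j) => // k kj; apply: z.
  - by rewrite xj in x0.
  - have := h2 j jn xj (fun k kj => z k.+1 kj).
    by case: (st) => //= d; rewrite addnS.
split=> [i j ij xi xj z|j jn xj z] /=.
  apply: (h1 i.+1 j.+1) => // -[//|k] kj; exact: z.
have: gap_ok (omap (addn j.+1) st).
  by apply: h2 => // -[|k] kj; [rewrite x0|exact: z].
by case: (st) => //= d; rewrite addnS.
Qed.

Definition word_fun n (w : {ffun 'I_n -> bool}) (i : nat) : bool :=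
  if insub i is Some j then w j else false.

Lemma word_funE n (w : {ffun 'I_n -> bool}) (i : 'I_n) : word_fun w i = w i.
Proof. by rewrite /word_fun valK. Qed.

Definition cons_word n (p : bool * {ffun 'I_n -> bool}) : {ffun 'I_n.+1 -> bool} :=
  [ffun i => if unlift ord0 i is Some j then p.2 j else p.1].

Definition uncons_word n (w : {ffun 'I_n.+1 -> bool}) : bool * {ffun 'I_n -> bool} :=
  (w ord0, [ffun j => w (lift ord0 j)]).

Lemma cons_wordK n : cancel (@cons_word n) (@uncons_word n).
Proof.
case=> b w; rewrite /uncons_word /cons_word /= ffunE unlift_none; congr (_, _).
by apply/ffunP => j; rewrite !ffunE liftK.
Qed.

Lemma uncons_wordK n : cancel (@uncons_word n) (@cons_word n).
Proof.
move=> w; apply/ffunP => i; rewrite /cons_word ffunE /=.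
by case: unliftP => [j|] ->; rewrite ?ffunE.
Qed.

Lemma word_fun_cons0 n b (w : {ffun 'I_n -> bool}) : word_fun (cons_word (b, w)) 0 = b.
Proof. by rewrite -[0]/(val (@ord0 n)) word_funE ffunE unlift_none. Qed.

Lemma word_fun_consS n b (w : {ffun 'I_n -> bool}) i : i < n ->
  word_fun (cons_word (b, w)) i.+1 = word_fun w i.
Proof.
move=> ilt; have -> : i.+1 = val (lift ord0 (Ordinal ilt)) by [].
by rewrite word_funE ffunE liftK /= -[X in word_fun w X]/(val (Ordinal ilt)) word_funE.
Qed.

Lemma card_legal n st :
  #|[set w : {ffun 'I_n -> bool} | legal n st (word_fun w)]%SET| = legal_count n st.
Proof.
elim: n st => [|n IH] st.
  rewrite /=; set A := finset _.
  have -> : A = [set: {ffun 'I_0 -> bool}]%SET by apply/setP => w; rewrite !inE.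
  by rewrite cardsT card_ffun card_ord card_bool.
rewrite -sum1_card (reindex (@cons_word n)) /=; last first.
  by exists (@uncons_word n) => w _; rewrite ?cons_wordK ?uncons_wordK.
under eq_bigl => p do rewrite inE.
rewrite big_mkcond /= -(pair_bigA _ (fun b w =>
  if legal n.+1 st (word_fun (cons_word (b, w))) then 1 else 0)) /=.
rewrite big_bool /= -!IH -!sum1_card; congr (_ + _).
  rewrite big_distrr /= [RHS]big_mkcond; apply: eq_bigr => w _.
  rewrite word_fun_cons0 inE muln1 (@eq_legal _ _ _ (word_fun w)); last first.
    by move=> i ilt; rewrite word_fun_consS.
  by case: (gap_ok st); case: legal.
rewrite [RHS]big_mkcond; apply: eq_bigr => w _.
rewrite word_fun_cons0 inE (@eq_legal _ _ _ (word_fun w)) // => i ilt.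
by rewrite word_fun_consS.
Qed.

(** Words are sorted by the number [j] of zeros before their first 1; the summand 1 is the all-zero
    word. *)
Lemma legal_count_Some n d :
  legal_count n (Some d) = 1 + \sum_(j < n) e (d + j) * legal_count (n - j.+1) (Some 0).
Proof.
elim: n d => [|n IH] d; first by rewrite big_ord0.
rewrite big_ord_recl /= (IH d.+1) addn0 subn1 /= [RHS]addnCA; congr (_ + (_ + _)).
by apply: eq_bigr => j _; rewrite /bump /= addSnnS subSS.
Qed.

Lemma legal_count_None n :
  legal_count n None = 1 + \sum_(j < n) legal_count j (Some 0).
Proof.
elim: n => [|n IH]; first by rewrite big_ord0.
by rewrite big_ord_recr /= IH mul1n addnC addnA.
Qed.

Variable R : realType.
Local Open Scope ring_scope.

(** In the renewal recursion the factor [n.+1] leaves room for the all-zero word; the other words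
    reproduce the bound because partial sums are at most 1. *)
Lemma legal_count_upper (t : R) n : 0 < t <= 1 ->
  (forall m, series (digit_term e t) m <= 1) ->
  (legal_count n (Some 0%N))%:R <= n.+1%:R / t ^+ n.
Proof.
case/andP => t0 t1 h; elim/ltn_ind: n => n IH.
rewrite legal_count_Some natrD natr_sum.
have inv1 k : 1 <= (t ^+ k)^-1 by rewrite invf_ge1 ?exprn_gt0 // exprn_ile1 // ltW.
rewrite -[X in _ <= X / _]natr1 mulrDl mul1r addrC; apply: lerD => //.
have -> : n%:R / t ^+ n = n%:R / t ^+ n * 1 :> R by rewrite mulr1.
apply: le_trans (_ : n%:R / t ^+ n * series (digit_term e t) n <= _); last first.
  by rewrite ler_wpM2l // divr_ge0 // exprn_ge0 // ltW.
rewrite /series /= big_mkord big_distrr /=; apply: ler_sum => j _.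
rewrite add0n natrM /digit_term mulrCA; apply: ler_wpM2l => //.
have jn := ltn_ord j.
apply: (le_trans (IH (n - j.+1)%N _)); first by lia.
have -> : n%:R / t ^+ n * t ^+ j.+1 = n%:R / t ^+ (n - j.+1).
  rewrite -[in t ^+ n](subnK jn) exprD; field.
  by rewrite !expf_neq0 ?gt_eqF.
rewrite ler_wpM2r //; last by rewrite ler_nat; lia.
by rewrite invr_ge0 exprn_ge0 // ltW.
Qed.

(** The factor [t ^+ m] makes the bound at most 1 for [n <= m]; for larger [n] the first [m] terms
    of the recursion reproduce it. *)
Lemma legal_count_lower (t : R) m n : 0 < t <= 1 ->
  1 <= series (digit_term e t) m ->
  t ^+ m / t ^+ n <= (legal_count n (Some 0%N))%:R.
Proof.
case/andP => t0 t1 h; elim/ltn_ind: n => n IH.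
rewrite legal_count_Some natrD natr_sum.
case: (leqP n m) => [nm|mn].
  apply: le_trans (_ : 1 <= _); last by rewrite lerDl sumr_ge0.
  by rewrite ler_pdivrMr ?exprn_gt0 // mul1r ler_wiXn2l // ltW.
apply: le_trans (_ : t ^+ m / t ^+ n * series (digit_term e t) m <= _).
  by rewrite ler_peMr // divr_ge0 // exprn_ge0 // ltW.
rewrite -[leLHS]add0r lerD //.
rewrite /series /= big_mkord big_distrr /= [leRHS](bigID (fun j : 'I_n => (j < m)%N)) /=.
rewrite -[leLHS]addr0 lerD ?sumr_ge0 //.
rewrite (big_ord_widen n (fun j : nat => t ^+ m / t ^+ n * digit_term e t j)) 1?ltnW //.
apply: ler_sum => j jm; have jn := ltn_ord j.
rewrite add0n natrM /digit_term mulrCA; apply: ler_wpM2l => //.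
apply: le_trans (IH (n - j.+1)%N _); last by lia.
rewrite -[in t ^+ n](subnK jn) exprD invfM -!mulrA mulVf ?mulr1 //.
by rewrite expf_neq0 ?gt_eqF.
Qed.

Lemma legal_count_None_upper (t : R) n : 0 < t <= 1 ->
  (forall m, series (digit_term e t) m <= 1) ->
  (legal_count n None)%:R <= n.+1%:R ^+ 2 / t ^+ n.
Proof.
move=> t01 h; rewrite legal_count_None natrD natr_sum.
case/andP: (t01) => t0 t1.
have inv1 k : 1 <= (t ^+ k)^-1 by rewrite invf_ge1 ?exprn_gt0 // exprn_ile1 // ltW.
have step j : (j < n)%N -> (legal_count j (Some 0%N))%:R <= n%:R / t ^+ n.
  move=> jn; apply: (le_trans (legal_count_upper j t01 h)).
  apply: ler_pM; rewrite ?invr_ge0 ?exprn_ge0 ?(ltW t0) // ?ler_nat //.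
  by rewrite lef_pV2 ?posrE ?exprn_gt0 // ler_wiXn2l ?(ltW t0) // ltnW.
apply: (@le_trans _ _ (1 + n%:R * (n%:R / t ^+ n))).
  rewrite lerD2l; apply: (@le_trans _ _ (\sum_(j < n) n%:R / t ^+ n)).
    by apply: ler_sum => j _; apply: step.
  by rewrite sumr_const card_ord -[leLHS]mulr_natl.
rewrite mulrA -[X in _ <= X ^+ 2 * _]natr1; have := inv1 n; set v := (t ^+ n)^-1 => v1.
have n0 : 0 <= n%:R :> R by [].
nra.
Qed.

Lemma legal_count_None_lower (t : R) m n : 0 < t <= 1 ->
  1 <= series (digit_term e t) m ->
  t ^+ m.+1 / t ^+ n <= (legal_count n None)%:R.
Proof.
move=> t01 h; case/andP: (t01) => t0 t1; case: n => [|n].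
  by rewrite expr0 divr1 exprn_ile1 // ltW.
rewrite legal_count_None big_ord_recr /= addnA natrD.
apply: (@le_trans _ _ (legal_count n (Some 0%N))%:R); last by rewrite lerDr.
apply: le_trans (legal_count_lower n t01 h).
by rewrite !exprS invfM mulrACA mulfV ?gt_eqF // mul1r.
Qed.

End Counting.

Lemma blocks_gap_shift (S : set nat) n :
  blocks (gap_shift S) n =
  [set w : {ffun 'I_n -> bool} | legal (fun i => `[< S i >]) n None (word_fun w)]%SET.
Proof.
apply/setP => w; rewrite !inE; apply/asboolP/legalP => [[x Xx [k wx]]|[h _]].
  have wE i : (i < n)%N -> word_fun w i = x (k + i%:Z).
    by move=> ilt; rewrite -[i]/(val (Ordinal ilt)) word_funE wx.
  split=> // i j /andP[ij jn]; rewrite !wE //; last exact: ltn_trans jn.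
  move=> xi xj z; apply/asboolP.
  have -> : (j - i).-1 = absz ((k + j%:Z) - (k + i%:Z) - 1)%R by lia.
  apply: Xx => // [|l il lj]; first by lia.
  have lE : l = k + (absz (l - k)%R)%:Z by lia.
  have := z (absz (l - k)%R); rewrite wE; last by lia.
  by rewrite -lE => /(_ ltac:(lia)) /negbTE.
(* Padding a legal word with zeros on both sides creates no new gap between ones. *)
pose x : binseq := fun i => (0 <= i) && word_fun w (absz i).
exists x; last first.
  exists 0 => i; rewrite /x add0r /= -word_funE.
  by [].
move=> i j ij; rewrite /x.
case: i ij => // i ij; case: j ij => // j ij wi wj z.
have jn : (j < n)%N.
  rewrite ltnNge; apply/negP => nj; move: wj; rewrite /word_fun /= insubF //.
  by apply/negbTE; rewrite -leqNgt.
have -> : absz (j%:Z - i%:Z - 1)%R = (j - i).-1 by lia.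
apply/asboolP; apply: h => // [|k ikj]; first by lia.
have := z k%:Z; rewrite /= => -> //; lia.
Qed.

(** * Entropy *)

Section Root.
Variables (R : realType) (e : nat -> bool).
Implicit Types t u : R.

(** Partial sums are used so that [t = 1], where the series may diverge, is covered. *)
Definition admissible : set R :=
  [set t | 0 <= t <= 1 /\ forall m, series (digit_term e t) m <= 1].

Definition gap_root : R := sup admissible.

Lemma admissible_half : admissible 2^-1.
Proof.
have h : 0 <= (2^-1 : R) < 1 by apply/andP; split; lra.
split; first by case/andP: h => -> /ltW ->.
move=> m; apply: (le_trans (digit_series_ge_partial e m h)).
apply: (le_trans (digit_series_le_geometric e h)).
by rewrite le_eqVlt; apply/orP; left; apply/eqP; field.
Qed.

Lemma has_sup_admissible : has_sup admissible.
Proof.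
split; first by exists 2^-1; exact: admissible_half.
by exists 1 => t [/andP[]].
Qed.

Lemma gap_root_ge_half : 2^-1 <= gap_root.
Proof. by apply: sup_upper_bound; [exact: has_sup_admissible|exact: admissible_half]. Qed.

Lemma gap_root_gt0 : 0 < gap_root.
Proof. by apply: lt_le_trans gap_root_ge_half; lra. Qed.

Lemma gap_root_le1 : gap_root <= 1.
Proof.
apply: ge_sup => [|t [/andP[]] //].
by exists 2^-1; exact: admissible_half.
Qed.

Lemma admissible_lt_gap_root u : 0 <= u < gap_root -> admissible u.
Proof.
case/andP => u0 ur; have d0 : 0 < gap_root - u by rewrite subr_gt0.
have [t [t01 ht]] := sup_adherent d0 has_sup_admissible.
rewrite -/gap_root opprB addrC subrK => ut; split.
  by rewrite u0 (le_trans (ltW ut)) //; case/andP: t01.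
move=> m; apply: le_trans (ht m).
by apply: ler_sum => i _; apply: digit_term_mono; rewrite u0 ltW.
Qed.

Lemma gt_gap_root_partial t : gap_root < t <= 1 -> exists m, 1 < series (digit_term e t) m.
Proof.
case/andP => rt t1; apply: contrapT => /forallNP h.
have : admissible t.
  split; first by rewrite t1 (le_trans (ltW gap_root_gt0)) // ltW.
  by move=> m; rewrite leNgt; apply/negP/h.
by move/(sup_upper_bound has_sup_admissible); rewrite leNgt rt.
Qed.

(** Continuity, through [digit_series_increment]: points below the root have value at most 1, and a
    value less than 1 at the root would leave a larger admissible point. *)
Lemma digit_series_gap_root : gap_root < 1 -> digit_series e gap_root = 1.
Proof.
move=> r1; have r0 := ltW gap_root_gt0.
apply/eqP; rewrite eq_le; apply/andP; split.
  apply/ler_addgt0Pr => d d0.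
  pose w := (1 - gap_root) ^+ 2; have w0 : 0 < w by rewrite exprn_gt0 // subr_gt0.
  pose u := Num.max 0 (gap_root - d * w).
  have u0 : 0 <= u by rewrite /u le_max lexx.
  have ur : u < gap_root by rewrite /u gt_max gap_root_gt0 ltrBlDr ltrDl mulr_gt0.
  have ru : gap_root - u <= d * w.
    by rewrite lerBlDr -lerBlDl /u le_max lexx orbT.
  have hu : digit_series e u <= 1.
    apply: digit_series_le; first by rewrite u0 (lt_trans ur).
    by have [|] := @admissible_lt_gap_root u; rewrite ?u0.
  have := @digit_series_increment R e gap_root u; rewrite u0 (ltW ur) => /(_ isT r1).
  have : (gap_root - u) / ((1 - gap_root) * (1 - u)) <= d.
    rewrite ler_pdivrMr ?mulr_gt0 ?subr_gt0 ?(lt_trans ur) //.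
    apply: (le_trans ru); rewrite ler_pM2l // /w expr2 ler_pM2l ?subr_gt0 //.
    by rewrite lerB // ltW.
  lra.
rewrite leNgt; apply/negP => h.
pose g := 1 - digit_series e gap_root; have g0 : 0 < g by rewrite subr_gt0.
(* Since [t] is kept at or below the midpoint of [gap_root] and 1, [w] bounds the denominator of the
   increment from below. *)
pose w := ((1 - gap_root) / 2) ^+ 2.
have w0 : 0 < w by rewrite exprn_gt0 // divr_gt0 ?subr_gt0.
pose t := Num.min ((1 + gap_root) / 2) (gap_root + g * w).
have rt : gap_root < t by rewrite /t lt_min ltrDl mulr_gt0 // andbT; lra.
have th : t <= (1 + gap_root) / 2 by rewrite /t ge_min lexx.
have t1 : t < 1 by apply: (le_lt_trans th); lra.
have tr : t - gap_root <= g * w by rewrite lerBlDl /t ge_min lexx orbT.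
have [m] := @gt_gap_root_partial t ltac:(by rewrite rt ltW).
apply/negP; rewrite -leNgt.
have t01 : 0 <= t < 1 by rewrite t1 (le_trans r0) // ltW.
apply: (le_trans (digit_series_ge_partial e m t01)).
have := @digit_series_increment R e t gap_root; rewrite r0 (ltW rt) => /(_ isT t1).
have : (t - gap_root) / ((1 - t) * (1 - gap_root)) <= g.
  rewrite ler_pdivrMr ?mulr_gt0 ?subr_gt0 //; apply: (le_trans tr).
  rewrite ler_pM2l // /w expr2.
  by apply: ler_pM; lra.
by rewrite /g; lra.
Qed.

Lemma gap_root_le t m : 0 <= t -> 1 < series (digit_term e t) m -> gap_root <= t.
Proof.
move=> t0 h; rewrite leNgt; apply/negP => tr.
have [_ /(_ m)] := @admissible_lt_gap_root t ltac:(by rewrite t0).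
by rewrite leNgt h.
Qed.

Lemma ln_legal_count_upper (d : R) : 0 < d -> exists C, forall n,
  ln (legal_count e n None)%:R + n%:R * ln gap_root <= d * n%:R + C :> R.
Proof.
(* The polynomial factor contributes [2 * ln n.+1]; the constant comes from [ln x <= x] at
   [x = n.+1%:R * (d / 4)]. *)
move=> d0; exists (d / 2 - 2 * ln (d / 4)) => n.
pose t : R := gap_root * expR (- (d / 2)).
have t0 : 0 < t by rewrite mulr_gt0 ?gap_root_gt0 ?expR_gt0.
have tr : t < gap_root.
  by rewrite gtr_pMr ?gap_root_gt0 // expR_lt1 oppr_lt0 divr_gt0.
have [t01 ht] : admissible t by apply: admissible_lt_gap_root; rewrite ltW.
have lnt : ln t = ln gap_root - d / 2 by rewrite lnM ?posrE ?gap_root_gt0 ?expR_gt0 // expRK.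
have := @legal_count_None_upper e R t n; rewrite t0 => /(_ _ ht) h.
have {}h := h ltac:(by case/andP: t01).
have L0 : 0 < (legal_count e n None)%:R :> R by rewrite legal_count_None ltr0n.
have n1 : 0 < n.+1%:R :> R by [].
rewrite -ler_ln ?posrE ?divr_gt0 ?exprn_gt0 // in h.
rewrite ln_div ?posrE ?exprn_gt0 // !lnXn // lnt in h.
have := @ln_sublinear R (n.+1%:R * (d / 4)); rewrite lnM ?posrE ?divr_gt0 // => /(_ _) q.
have {}q := q ltac:(by rewrite mulr_gt0 // divr_gt0).
rewrite -[X in _ <= X - _]mulr_natl -[X in _ - X]mulr_natl in h.
move: h q; rewrite -![n.+1%:R]natr1.
lra.
Qed.

Lemma ln_legal_count_lower (d : R) : 0 < d -> exists C, forall n,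
  - (d * n%:R + C) <= ln (legal_count e n None)%:R + n%:R * ln gap_root :> R.
Proof.
move=> d0; pose t : R := gap_root * expR d.
have t0 : 0 < t by rewrite mulr_gt0 ?gap_root_gt0 ?expR_gt0.
have lnt : ln t = ln gap_root + d by rewrite lnM ?posrE ?gap_root_gt0 ?expR_gt0 // expRK.
(* If [t > 1] then [ln gap_root > - d], and a count of at least 1 suffices. *)
have [t1|t1] := leP t 1; last first.
  exists 0 => n.
  have L0 : 0 <= ln ((legal_count e n None)%:R : R).
    by apply: ln_ge0; rewrite legal_count_None ler1n.
  have lt0 : 0 < ln t by apply: ln_gt0.
  have n0 : 0 <= n%:R :> R by [].
  by rewrite lnt in lt0; nra.
have rt : gap_root < t by rewrite ltr_pMr ?gap_root_gt0 // expR_gt1.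
have [m hm] := @gt_gap_root_partial t ltac:(by rewrite rt t1).
exists (- (m.+1%:R * ln t)) => n.
have := @legal_count_None_lower e R t m n; rewrite t0 t1 (ltW hm) => /(_ isT isT) h.
have L0 : 0 < (legal_count e n None)%:R :> R by rewrite legal_count_None ltr0n.
rewrite -ler_ln ?posrE ?divr_gt0 ?exprn_gt0 // in h.
rewrite ln_div ?posrE ?exprn_gt0 // !lnXn // in h.
rewrite -[X in X - _ <= _]mulr_natl -[X in _ - X <= _]mulr_natl in h.
move: h; rewrite lnt.
nra.
Qed.

End Root.

Definition gap_digits (S : set nat) : nat -> bool := fun i => `[< S i >].

Lemma entropy_gap_shift (R : realType) (S : set nat) :
  entropy (gap_shift S) = - ln (gap_root R (gap_digits S)) / ln 2 :> R.
Proof.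
set r := gap_root R _; apply/cvg_lim => //; apply/cvgrPdist_le => d d0.
have l2 : 0 < ln 2 :> R by apply: ln_gt0; lra.
have e0 : 0 < d * ln 2 / 2 by rewrite divr_gt0 // mulr_gt0.
have [C hC] := ln_legal_count_upper (gap_digits S) e0.
have [D hD] := ln_legal_count_lower (gap_digits S) e0.
(* From this index on the constants [C] and [D] use at most half of the tolerance; the linear terms
   use the other half. *)
exists (Num.trunc ((`|C| + `|D|) / (d * ln 2 / 2))).+1 => //= n /= nlarge.
have n0 : 0 < n%:R :> R by rewrite ltr0n; apply: leq_trans nlarge.
have hn : `|C| + `|D| <= d * ln 2 / 2 * n%:R.
  rewrite mulrC -ler_pdivrMr //; set z := (_ / _).
  have /andP[_ /ltW h] := @truncn_itv R z ltac:(by rewrite divr_ge0 ?addr_ge0 // ltW).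
  by apply: (le_trans h); rewrite ler_nat.
have -> : #|blocks (gap_shift S) n| = legal_count (gap_digits S) n None.
  by rewrite blocks_gap_shift card_legal.
have := hC n; have := hD n; rewrite -/r.
set L := ln (legal_count _ _ _)%:R => hD' hC'.
have -> : - ln r / ln 2 - L / (n%:R * ln 2) = - ((L + n%:R * ln r) / (n%:R * ln 2)).
  by field; rewrite !gt_eqF.
rewrite normrN normrM [X in _ * X]gtr0_norm ?invr_gt0 ?mulr_gt0 //.
rewrite ler_pdivrMr ?mulr_gt0 // ler_norml.
have := ler_norm C; have := ler_norm D; have := normr_ge0 C; have := normr_ge0 D.
move=> a1 a2 a3 a4; apply/andP; split; lra.
Qed.

(** * Unique expansions *)

Section Univoque.
Variables (R : realType) (N : nat).
Implicit Types (e f : nat -> bool) (t : R).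

(** The windows of the third clause start at place [N.+2] or later, just past the initial ones. *)
Definition balanced e :=
  [/\ forall i, (i < N.+2)%N -> e i,
      forall n, exists2 j, (j < N)%N & e (n.+1 + j)%N &
      forall n, (N < n)%N -> exists2 j, (j < N)%N & ~~ e (n.+1 + j)%N].

Definition near_half t := 2^-1 <= t <= 2 / 3 /\ 2 * t - 1 <= t ^+ N.+3.

Lemma near_half_lt1 t : near_half t -> 0 <= t < 1.
Proof. by move=> [/andP[a b] _]; apply/andP; split; lra. Qed.

Lemma near_half_tail e t m : near_half t -> (m < N)%N -> ~~ e m ->
  digit_series e t <= 1 - t ^+ N / 9.
Proof.
move=> ht mN em; have t01 := near_half_lt1 ht; case: ht => /andP[ha hb] hc.
apply: (le_trans (digit_series_le_of_zero t01 em)).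
have hm : t ^+ N <= t ^+ m.+1.
  by rewrite ler_wiXn2l //; case/andP: t01 => ? /ltW.
have -> : t / (1 - t) = 1 + (2 * t - 1) / (1 - t) by field; rewrite subr_eq0 gt_eqF //; lra.
have X0 : 0 <= t ^+ N by rewrite exprn_ge0 //; case/andP: t01.
(* The all-ones value exceeds 1 by at most [3 * t ^+ N.+3], and [3 * (2 / 3) ^+ 3 = 8 / 9]; the
   missing digit costs at least [t ^+ N]. *)
have : (2 * t - 1) / (1 - t) <= 8 / 9 * t ^+ N.
  rewrite ler_pdivrMr; last by lra.
  apply: (le_trans hc); rewrite -(addn3 N) exprD mulrAC mulrC ler_wpM2r //.
  have : t ^+ 3 <= (2 / 3) ^+ 3 by rewrite lerXn2r ?nnegrE //; lra.
  lra.
lra.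
Qed.

(** At place [n] the series of [f] gains [t ^+ n.+1], while the later digits of [e] recover at most
    [1 - t ^+ N / 9] times that. *)
Lemma digit_series_gap e f t n m : near_half t ->
  (forall i, (i < n)%N -> e i = f i) -> ~~ e n -> f n ->
  (m < N)%N -> ~~ e (n.+1 + m)%N ->
  t ^+ (n.+1 + N) / 9 <= digit_series f t - digit_series e t.
Proof.
move=> ht ef en fn mN em; have t01 := near_half_lt1 ht; have /andP[t0 t1] := t01.
rewrite (digit_series_split e n.+1 t01).
have tail := @near_half_tail (fun i => e (n.+1 + i)%N) t m ht mN em.
have head := digit_series_ge_partial f n.+1 t01.
have eqs : series (digit_term f t) n.+1 = series (digit_term e t) n.+1 + t ^+ n.+1.
  rewrite /series /= !big_nat_recr //= {2 4}/digit_term fn (negbTE en) mul0r addr0 mul1r.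
  by congr (_ + _); apply: eq_big_nat => i /andP[_ ilt]; rewrite /digit_term ef.
have X0 : 0 <= t ^+ n.+1 by rewrite exprn_ge0.
rewrite exprD; move: X0 tail head eqs.
set a := digit_series _ t; set X := t ^+ n.+1; set Y := t ^+ N => X0 tail head eqs.
have := ler_wpM2l X0 tail; rewrite mulrBr mulr1; lra.
Qed.

(** At the first difference, a 0 of [e] lies beyond the initial ones and is followed by another 0 in
    the next window, so [f] has the larger value. A 1 of [e] is the same situation for the
    complementary digits. *)
Lemma digit_series_eq1_inj e f t : balanced e -> near_half t ->
  digit_series e t = digit_series f t -> e = f.
Proof.
case=> e1 e2 e3 ht ef; have t01 := near_half_lt1 ht.
have p0 k : 0 < t ^+ k / 9.
  have [/andP[ha _] _] := ht; by rewrite divr_gt0 // exprn_gt0 // (lt_le_trans _ ha) // invr_gt0.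
apply/funext; apply: contrapT => /existsNP ex.
have {}ex : exists n, e n != f n by case: ex => n /eqP; exists n.
case: (ex_minnP ex) => n nef nmin.
have agree i : (i < n)%N -> e i = f i.
  by move=> ilt; apply/eqP; apply: contraTT ilt => /nmin; rewrite -leqNgt.
case en: (e n) in nef.
  have [m mN em] := e2 n.
  have := @digit_series_gap (fun i => ~~ e i) (fun i => ~~ f i) t n m ht.
  rewrite /= en mN em => /(_ (fun i ilt => congr1 negb (agree i ilt)) isT _ isT isT) h.
  have {}h := h ltac:(by case: (f n) nef).
  have := p0 (n.+1 + N)%N.
  have := digit_seriesC e t01; have := digit_seriesC f t01; lra.
have Nn : (N < n)%N by rewrite ltnNge; apply/negP => nN; move: (e1 n); rewrite en; lia.
have [m mN em] := e3 n Nn.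
have := @digit_series_gap e f t n m ht agree; rewrite en mN em => /(_ isT _ isT isT) h.
have {}h := h ltac:(by case: (f n) nef).
by have := p0 (n.+1 + N)%N; lra.
Qed.

Hypothesis N0 : (0 < N)%N.

Lemma partial_ones e t n : (forall i, (i < n)%N -> e i) ->
  (1 - t) * series (digit_term e t) n = t - t ^+ n.+1.
Proof.
elim: n => [|n IH] h; first by rewrite /series /= big_geq // mulr0 expr1 subrr.
rewrite /series /= big_nat_recr //= mulrDr IH => [|i ilt]; last by apply: h; lia.
by rewrite /digit_term h // mul1r [t ^+ n.+2]exprS; ring.
Qed.

Lemma gap_root_near_half e : balanced e -> near_half (gap_root R e).
Proof.
case=> e1 e2 e3; have rle : gap_root R e <= 2 / 3.
  (* The first three digits are 1, and [2/3 + 4/9 + 8/27 > 1]. *)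
  apply: (@gap_root_le _ _ _ 3); first by lra.
  rewrite /series /= !big_nat_recr //= big_geq // /digit_term !e1 //; [|lia..].
  by rewrite !mul1r; lra.
have r1 : gap_root R e < 1 by apply: (le_lt_trans rle); lra.
split; first by rewrite gap_root_ge_half rle.
have r01 : 0 <= gap_root R e < 1 by rewrite r1 ltW ?gap_root_gt0.
(* The initial ones contribute at most 1; multiplied by [1 - t] this reads
   [t - t ^+ N.+3 <= 1 - t]. *)
have h := digit_series_ge_partial e N.+2 r01.
rewrite digit_series_gap_root // in h.
have := partial_ones (gap_root R e) e1.
have := ler_wpM2l (_ : 0 <= 1 - gap_root R e) h; rewrite subr_ge0 (ltW r1) => /(_ isT).
by lra.
Qed.

Lemma gap_root_lt1 e : balanced e -> gap_root R e < 1.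
Proof. by move/gap_root_near_half/near_half_lt1 => /andP[]. Qed.

(** At 1/2 the all-ones sequence has value exactly 1, so a single zero digit brings the value below
    1. *)
Lemma gap_root_gt_half e : balanced e -> 2^-1 < gap_root R e.
Proof.
move=> be; rewrite lt_neqAle gap_root_ge_half andbT; apply/negP => /eqP rE.
have h1 := digit_series_gap_root (gap_root_lt1 be).
have h01 := near_half_lt1 (gap_root_near_half be).
case: be => _ _ /(_ N.+1 (leqnn _)) [j jN ej].
have := digit_series_le_of_zero h01 ej; rewrite h1 -rE.
have -> : 2^-1 / (1 - 2^-1) = 1 :> R by field.
have : 0 < (2^-1 : R) ^+ (N.+2 + j).+1 by rewrite exprn_gt0 // invr_gt0.
lra.
Qed.

(** At the root of [e] the series of [f] exceeds 1 by the amount in [digit_series_gap]. Its slope is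
    at most 9 up to 2/3, so its own root lies correspondingly lower. *)
Lemma gap_root_separation e f n : balanced e -> balanced f ->
  (forall i, (i < n)%N -> e i = f i) -> ~~ e n -> f n ->
  2^-1 ^+ (n + N + 8) <= gap_root R e - gap_root R f.
Proof.
have w (a b : R) : a <= 2 / 3 -> b <= 2 / 3 -> 1 <= 9 * ((1 - a) * (1 - b)).
  move=> ha hb; have -> : 9 * ((1 - a) * (1 - b)) = 3 * (1 - a) * (3 * (1 - b)) by ring.
  by rewrite -[leLHS]mulr1; apply: ler_pM; lra.
move=> be bf ef en fn.
have [he hf] := (gap_root_near_half be, gap_root_near_half bf).
have [e1 _ e3] := be.
have Nn : (N < n)%N by rewrite ltnNge; apply/negP => nN; move: (e1 n); rewrite (negbTE en); lia.
have [m mN em] := e3 n Nn.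
have := digit_series_gap he ef en fn mN em.
have de := digit_series_gap_root (gap_root_lt1 be); have df := digit_series_gap_root (gap_root_lt1 bf).
rewrite de; have /andP[t0 t1] := near_half_lt1 he; have /andP[u0 u1] := near_half_lt1 hf.
have [/andP[t2 t3] _] := he; have [/andP[u2 u3] _] := hf.
set t := gap_root R e in de t0 t1 t2 t3 *; set u := gap_root R f in df u0 u1 u2 u3 *.
move=> gap.
have powt : 2^-1 ^+ (n.+1 + N) <= t ^+ (n.+1 + N) by rewrite lerXn2r ?nnegrE //; lra.
have pow0 : 0 < (2^-1 : R) ^+ (n.+1 + N) by rewrite exprn_gt0 // invr_gt0.
have ut : u <= t.
  rewrite leNgt; apply/negP => tu.
  have := @digit_series_mono R f u t; rewrite t0 (ltW tu) => /(_ isT u1); lra.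
have := @digit_series_increment R f t u; rewrite u0 ut => /(_ isT t1).
have : (t - u) / ((1 - t) * (1 - u)) <= 9 * (t - u).
  rewrite ler_pdivrMr; last by rewrite mulr_gt0 // subr_gt0.
  rewrite -mulrA mulrCA -[leLHS]mulr1 ler_wpM2l ?subr_ge0 //; exact: w.
(* The gap and the slope each lose a factor 9, and [81 <= 2 ^ 7]. *)
have -> : (n + N + 8 = n.+1 + N + 7)%N by rewrite addSn addSnnS.
rewrite exprD; move: powt pow0 gap; set X := _ ^+ (n.+1 + N); set Y := t ^+ _.
lra.
Qed.

End Univoque.

(** * Embedding free binary sequences into balanced ones *)

Section Coding.
Variable K : nat.
Implicit Types b : nat -> bool.
Local Open Scope nat_scope.

(* [K + 4] ones, then blocks made of [K] consecutive terms of [b] followed by 0 1. *)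
Definition code b (i : nat) : bool :=
  (i < K.+4) ||
  (let j := i - K.+4 in
   if j %% K.+2 < K then b (j %/ K.+2 * K + j %% K.+2) else j %% K.+2 == K.+1).

Definition code_pos (k : nat) := K.+4 + (k %/ K * K.+2 + k %% K).

Lemma code_block b a r : r < K.+2 ->
  code b (K.+4 + (a * K.+2 + r)) = if r < K then b (a * K + r) else r == K.+1.
Proof.
move=> rK; rewrite /code ltnNge leq_addr /= addKn.
by rewrite modnMDl divnMDl // modn_small // divn_small // addn0.
Qed.

Lemma code_posE b k : 0 < K -> code b (code_pos k) = b k.
Proof.
move=> K0; have r := ltn_pmod k K0.
by rewrite /code_pos code_block ?r -?divn_eq //; lia.
Qed.

(** Deleting the two fixed letters of each block preserves the order of the free places. *)
Lemma block_index_mono a r a' r' : r < K -> r' < K ->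
  a * K.+2 + r < a' * K.+2 + r' -> a * K + r < a' * K + r'.
Proof.
move=> rK rK'; case: (ltngtP a a') => [aa' _|a'a|->]; last by rewrite !ltn_add2l.
  apply: leq_trans (leq_addr _ _); apply: leq_trans (leq_mul aa' (leqnn K)).
  by rewrite mulSn addnC ltn_add2r.
rewrite ltnNge => /negP[]; apply: leq_trans (leq_addr _ _).
apply: leq_trans (leq_mul a'a (leqnn K.+2)).
by rewrite mulSn addnC leq_add2r; lia.
Qed.

Lemma eq_code b b' k : 0 < K -> (forall i, i < k -> b i = b' i) ->
  forall i, i < code_pos k -> code b i = code b' i.
Proof.
move=> K0 bb i ilt; have [iK|iK] := ltnP i K.+4; first by rewrite /code iK.
rewrite -(subnKC iK) in ilt *; set j := i - K.+4 in ilt *.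
move: ilt; rewrite /code_pos ltn_add2l.
have rj : j %% K.+2 < K.+2 by rewrite ltn_pmod.
rewrite (divn_eq j K.+2) !code_block // => lt; case: ifP => // rK; apply: bb.
by rewrite [X in _ < X](divn_eq k K); apply: block_index_mono; rewrite ?ltn_pmod.
Qed.

(** The free places have density [K / (K + 2)], which is the source of the Hölder exponent. *)
Lemma code_pos_bound k : (code_pos k - K.+4) * K <= k * K.+2.
Proof.
rewrite /code_pos addKn [X in _ <= X * _](divn_eq k K) !mulnDl mulnAC leq_add2l.
by rewrite leq_mul2l; apply/orP; right; lia.
Qed.

(** A window of length [K.+2] past the initial ones meets every residue modulo [K.+2], hence the
    fixed 0 at residue [K] and the fixed 1 at residue [K.+1]. *)
Lemma balanced_code b : balanced K.+2 (code b).
Proof.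
have window n c : c < K.+2 -> exists2 j, j < K.+2 & exists a,
    (K.+4 <= n.+1) -> n.+1 + j = K.+4 + (a * K.+2 + c).
  move=> cK; pose m := n.+1 - K.+4; have rm : m %% K.+2 < K.+2 by rewrite ltn_pmod.
  have mE := divn_eq m K.+2.
  have [le|lt] := leqP (m %% K.+2) c.
    exists (c - m %% K.+2); first by lia.
    by exists (m %/ K.+2) => h; rewrite /m in mE rm le *; lia.
  exists (K.+2 + c - m %% K.+2); first by lia.
  by exists (m %/ K.+2).+1 => h; rewrite mulSn /m in mE rm lt *; lia.
split.
- by move=> i iK; rewrite /code iK.
- move=> n; have [nK|nK] := ltnP n.+1 K.+4.
    by exists 0 => //; rewrite addn0 /code nK.
  have [j jK [a /(_ nK) jE]] := window n K.+1 (leqnn _).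
  by exists j => //; rewrite jE code_block // ltnNge leqnSn /= eqxx.
- move=> n nK; have [j jK [a jE]] := window n K (leqnSn _).
  exists j => //; rewrite jE ?code_block ?ltnn //; lia.
Qed.

End Coding.

(** * Binary digits of real numbers *)

Section BinaryDigits.
Variable R : realType.
Implicit Types y z : R.

Definition binary_digit y (k : nat) : bool := odd (Num.trunc (y * 2 ^+ k.+1)).

Lemma truncn_double z : 0 <= z ->
  Num.trunc (z * 2) = ((Num.trunc z).*2 + odd (Num.trunc (z * 2)))%N.
Proof.
move=> z0; have /andP[a1 a2] := truncn_itv z0.
have /andP[b1 b2] := @truncn_itv R (z * 2) ltac:(by rewrite mulr_ge0).
move: a1 a2 b1 b2; set a := Num.trunc z; set b := Num.trunc _ => a1 a2 b1 b2.
have h1 : (a * 2 < b.+1)%N by rewrite -(ltr_nat R) natrM; lra.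
have h2 : (b < a.+1 * 2)%N by rewrite -(ltr_nat R) natrM; lra.
by have := odd_double_half b; lia.
Qed.

Lemma eq_binary_digits y z k : 0 <= y < 1 -> 0 <= z < 1 ->
  (forall i, (i < k)%N -> binary_digit y i = binary_digit z i) ->
  `|y - z| <= 2^-1 ^+ k.
Proof.
move=> /andP[y0 y1] /andP[z0 z1] h.
(* Each digit determines the next integer part by doubling, so equal digits give equal integer
   parts. *)
have tE : Num.trunc (y * 2 ^+ k) = Num.trunc (z * 2 ^+ k).
  elim: k h => [|k IH] h; first by rewrite !mulr1 (@truncn_def R y 0) ?(@truncn_def R z 0) ?y0 ?z0.
  have hk := h k (leqnn _).
  rewrite /binary_digit !exprSr !mulrA in hk *.
  rewrite truncn_double ?mulr_ge0 ?exprn_ge0 // hk IH => [|i ik].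
    by rewrite -truncn_double // mulr_ge0 ?exprn_ge0.
  by apply: h; rewrite ltnS ltnW.
have p0 : 0 < (2 : R) ^+ k by rewrite exprn_gt0.
have /andP[a1 a2] := @truncn_itv R (y * 2 ^+ k) ltac:(by rewrite mulr_ge0 // ltW).
have /andP[b1 b2] := @truncn_itv R (z * 2 ^+ k) ltac:(by rewrite mulr_ge0 // ltW).
rewrite -tE in b1 b2; move: a2 b2; rewrite -natr1 => a2 b2.
rewrite exprVn -[leRHS]mul1r ler_pdivlMr // -[X in _ * X](ger0_norm (ltW p0)) -normrM mulrBl.
by rewrite ler_norml; apply/andP; split; lra.
Qed.

Lemma binary_digits_neq y z : 0 <= y < 1 -> 0 <= z < 1 -> y != z ->
  exists k, (forall i, (i < k)%N -> binary_digit y i = binary_digit z i) /\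
            binary_digit y k != binary_digit z k.
Proof.
move=> y01 z01 yz.
suff ex : exists k, binary_digit y k != binary_digit z k.
  case: (ex_minnP ex) => n nd nmin; exists n; split=> // i ilt.
  by apply/eqP; apply: contraTT ilt => /nmin; rewrite -leqNgt.
apply: contrapT => /forallNP h.
have d0 : 0 < `|y - z| by rewrite normr_gt0 subr_eq0.
have := @cvg_expr R 2^-1 ltac:(by rewrite ger0_norm; lra).
move=> /cvgrPdist_lt /(_ _ d0) [n _ /(_ n (leqnn _))] /=.
rewrite sub0r normrN ger0_norm ?exprn_ge0 ?invr_ge0 // ltNge.
rewrite (@eq_binary_digits y z n) // => i _.
by apply/eqP/negPn/negP/h.
Qed.

End BinaryDigits.

(** * The parametrisation by entropy and its Hölder inverse *)

Section Parametrisation.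
Variables (R : realType) (K : nat).
Hypothesis K0 : (0 < K)%N.
Implicit Types y z : R.

Definition param_root y : R := gap_root R (code K (binary_digit y)).
Definition param y : R := - ln (param_root y) / ln 2.

Lemma ln2_gt0 : 0 < ln 2 :> R.
Proof. by apply: ln_gt0; lra. Qed.

(** On ]0, 1] the logarithm has slope at least 1, and dividing by [ln 2 <= 1] only enlarges
    distances. *)
Lemma param_lower y z : 0 < param_root z <= param_root y -> param_root y <= 1 ->
  param_root y - param_root z <= param z - param y.
Proof.
rewrite /param; set t := param_root y; set u := param_root z => /andP[u0 ut] t1.
have t0 := lt_le_trans u0 ut; have l2 := ln2_gt0.
have l21 : ln 2 <= 1 :> R by rewrite -[2]/(1 + 1) le_ln1Dx //; lra.
have h : t - u <= ln t - ln u.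
  have := @le_ln1Dx R (u / t - 1) ltac:(by rewrite ltrBrDl subrr divr_gt0).
  rewrite addrC subrK ln_div ?posrE // => q.
  have : t - u <= 1 - u / t.
    have -> : 1 - u / t = (t - u) / t by field; rewrite gt_eqF.
    by rewrite ler_pdivlMr // ler_piMr // subr_ge0.
  lra.
have -> : - ln u / ln 2 - - ln t / ln 2 = (ln t - ln u) / ln 2 by field; rewrite gt_eqF.
rewrite ler_pdivlMr //; apply: le_trans h.
by rewrite ler_piMr // subr_ge0.
Qed.

Lemma param_gap y z k :
  (forall i, (i < k)%N -> binary_digit y i = binary_digit z i) ->
  binary_digit y k != binary_digit z k ->
  2^-1 ^+ (code_pos K k + K.+2 + 8) <= `|param y - param z|.
Proof.
wlog yk : y z / ~~ binary_digit y k => [wl h hk|h hk].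
  case yk: (binary_digit y k); last by apply: wl => //; rewrite yk.
  rewrite distrC; apply: wl.
  - by move: hk; rewrite yk; case: (binary_digit z k).
  - by move=> i ik; rewrite h.
  - by rewrite eq_sym.
have := @gap_root_separation R K.+2 isT _ _ (code_pos K k) (balanced_code K (binary_digit y))
  (balanced_code K (binary_digit z)) (eq_code K0 h).
rewrite !code_posE // => /(_ yk _) gap.
have {}gap := gap ltac:(by move: hk yk; case: binary_digit; case: binary_digit).
apply: (le_trans gap); rewrite distrC; apply: le_trans (ler_norm _).
have p0 : 0 < (2^-1 : R) ^+ (code_pos K k + K.+2 + 8) by rewrite exprn_gt0 // invr_gt0.
apply: param_lower; last exact: gap_root_le1.
by rewrite gap_root_gt0 -subr_ge0 (le_trans (ltW p0)).
Qed.

Lemma powR_half_ge (s : R) m l : s * m%:R <= l%:R ->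
  2^-1 ^+ l <= (2^-1 ^+ m) `^ s :> R.
Proof.
move=> h; have i0 : 0 <= 2^-1 :> R by lra.
rewrite -!powR_mulrn // -powRrM; apply: ger_powR; first by apply/andP; split; lra.
by rewrite mulrC.
Qed.

(** If [k] is the first differing binary digit, then [y] and [z] are within [2^-k], while
    [param_gap] bounds the other distance below with exponent about [k * (K + 2) / K]. The power of
    2 in front absorbs the additive constants. *)
Lemma param_holder (s : R) y z : 0 <= s <= 1 -> s * K.+2%:R <= K%:R ->
  0 <= y < 1 -> 0 <= z < 1 ->
  `|y - z| <= 2 ^+ (K.+4 + K.+2 + 8) * `|param y - param z| `^ s.
Proof.
move=> /andP[s0 s1] sK y01 z01; have [->|yz] := eqVneq y z.
  by rewrite subrr normr0 mulr_ge0 ?powR_ge0 // exprn_ge0.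
have [k [h hk]] := binary_digits_neq y01 z01 yz.
apply: (le_trans (eq_binary_digits y01 z01 h)).
set A := (K.+4 + K.+2 + 8)%N.
have -> : 2^-1 ^+ k = 2 ^+ A * 2^-1 ^+ (A + k) :> R.
  by rewrite [2^-1 ^+ (A + k)]exprD mulrA -exprMn mulfV ?expr1n ?mul1r.
rewrite ler_wpM2l ?exprn_ge0 //.
apply: (@le_trans _ _ ((2^-1 ^+ (code_pos K k + K.+2 + 8)) `^ s)); last first.
  by apply: ge0_ler_powR; rewrite ?nnegrE ?exprn_ge0 ?invr_ge0 //; apply: param_gap.
apply: powR_half_ge.
have pE : (code_pos K k + K.+2 + 8 = A + (code_pos K k - K.+4))%N.
  by rewrite /A /code_pos addKn; move: (_ + k %% K)%N => x; lia.
rewrite pE !natrD mulrDr; apply: lerD.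
  by rewrite -natrD ler_piMl.
have bd := code_pos_bound K k; rewrite -(ler_nat R) !natrM in bd.
have K0' : 0 < K%:R :> R by rewrite ltr0n.
have K2 : 0 < K.+2%:R :> R by rewrite ltr0n.
rewrite -(ler_pM2r K2); apply: le_trans bd.
rewrite mulrAC mulrC; by rewrite ler_wpM2l.
Qed.

End Parametrisation.

(** * Hausdorff measure *)

Section Hausdorff.
Variable R : realType.
Implicit Types (A E : set R) (s d : R).

Lemma ediam_le A d : (forall x y, A x -> A y -> `|x - y| <= d) -> (ediam A <= d%:E)%E.
Proof. by move=> h; apply: ge_ereal_sup => _ [x Ax [y Ay <-]]; rewrite lee_fin h. Qed.

Lemma dist_le_ediam A d x y : (ediam A <= d%:E)%E -> A x -> A y ->
  `|x - y| <= fine (ediam A).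
Proof.
move=> hd Ax Ay.
have h : (`|x - y|%:E <= ediam A)%E by apply: ereal_sup_ubound; exists x => //; exists y.
rewrite -lee_fin fineK // fin_real //.
by rewrite (lt_le_trans (ltNyr _) h) (le_lt_trans hd (ltry _)).
Qed.

Lemma hpow_ge0 s A : (0 <= hpow s A)%E.
Proof. by rewrite /hpow; case: asboolP => // _; rewrite lee_fin powR_ge0. Qed.

Lemma hpow_le s d A : 0 <= s -> 0 <= d -> (ediam A <= d%:E)%E ->
  (hpow s A <= (d `^ s)%:E)%E.
Proof.
move=> s0 d0 hd; rewrite /hpow; case: asboolP => [_|/eqP/set0P[x Ax]].
  by rewrite lee_fin powR_ge0.
have h0 : 0 <= fine (ediam A) by apply: le_trans (dist_le_ediam hd Ax Ax).
rewrite lee_fin ge0_ler_powR ?nnegrE // -lee_fin fineK // fin_real //.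
rewrite (le_lt_trans hd (ltry _)) andbT (@lt_le_trans _ _ 0%E) //.
by apply: ereal_sup_ubound; exists x => //; exists x => //; rewrite subrr normr0.
Qed.

Lemma hausdorff_pre_ge0 s d E : (0 <= hausdorff_pre s d E)%E.
Proof.
by apply: le_ereal_inf_tmp => _ [F _ <-]; apply: nneseries_ge0 => *; apply: hpow_ge0.
Qed.

Lemma hausdorff_pre_le_measure s d E : 0 < d ->
  (hausdorff_pre s d E <= hausdorff_measure s E)%E.
Proof. by move=> d0; apply: ereal_sup_ubound; exists d. Qed.

(** A cover by [n] intervals of length [w = 1 / n] costs at most [n * w ^ s = w ^ (s - 1)], which
    tends to 0. *)
Lemma hausdorff_measure_unit_gt1 s E : E `<=` `[0, 1] -> 1 < s ->
  hausdorff_measure s E = 0%E.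
Proof.
move=> E01 s1; apply/eqP; rewrite eq_le; apply/andP; split; last first.
  exact: le_trans (hausdorff_pre_ge0 s 1 E) (hausdorff_pre_le_measure _ _ ltr01).
apply: ge_ereal_sup => _ [d /= d0 <-]; apply/lee_addgt0Pr => c c0; rewrite add0e.
(* A length at most [v] meets the mesh bound [d] and makes the cost at most [c]. *)
pose v := Num.min d (c `^ (s - 1)^-1).
have v0 : 0 < v by rewrite lt_min d0 powR_gt0.
have [n npos wv] : exists2 n, (0 < n)%N & n%:R^-1 <= v.
  exists (Num.trunc v^-1).+1 => //; rewrite -[v in leRHS]invrK lef_pV2 ?posrE ?invr_gt0 //.
  by have /andP[_ /ltW] := @truncn_itv R v^-1 ltac:(by rewrite invr_ge0 ltW).
have n0 : 0 < n%:R :> R by rewrite ltr0n.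
pose w : R := n%:R^-1; have w0 : 0 < w by rewrite invr_gt0.
pose F (i : nat) : set R := if (i < n)%N then `[i%:R * w, i.+1%:R * w]%classic else set0.
have Fd i : (ediam (F i) <= w%:E)%E.
  apply: ediam_le => x y; rewrite /F; case: ifP => // _ /=.
  rewrite !in_itv /= -natr1 mulrDl mul1r => /andP[x1 x2] /andP[y1 y2].
  by rewrite ler_norml; apply/andP; split; lra.
have s0 : 0 <= s by lra.
apply: (@le_trans _ _ (\sum_(0 <= i <oo) hpow s (F i))%E).
  apply: ereal_inf_lbound; exists F => //; split; last first.
    move=> i; apply: (le_trans (Fd i)); rewrite lee_fin (le_trans wv) //.
    by rewrite ge_min lexx.
  move=> x /E01 /=; rewrite in_itv /= => /andP[x0 x1].
  (* The point 1 belongs to the last interval; truncation would give the index [n], where [F] is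
     empty. *)
  have [xE|xlt] := eqVneq x 1.
    exists n.-1 => //; rewrite /F ltn_predL npos /= in_itv /= prednK //.
    by rewrite xE /w divff ?gt_eqF // lexx andbT ler_pdivrMr // mul1r ler_nat leq_pred.
  have {}xlt : x < 1 by rewrite lt_neqAle xlt.
  have /andP[t1 t2] := @truncn_itv R (x * n%:R) ltac:(by rewrite mulr_ge0 // ltW).
  exists (Num.trunc (x * n%:R)) => //; rewrite /F ifT; last first.
    by rewrite -(ltr_nat R); apply: (le_lt_trans t1); rewrite gtr_pMl.
  by rewrite /= in_itv /= ler_pdivrMr // t1 ler_pdivlMr // ltW.
rewrite (@nneseries_split R _ 0 n); last by move=> *; apply: hpow_ge0.
rewrite add0n [X in (_ + X)%E]eseries0 ?adde0; last first.
  move=> i ni _; rewrite /F ifN ?ltnNge ?ni // /hpow.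
  by case: asboolP.
apply: (@le_trans _ _ (\sum_(0 <= i < n) (w `^ s)%:E)%E).
  by apply: lee_sum => i _; apply: hpow_le => //; exact: ltW.
rewrite sumEFin lee_fin sumr_const_nat subn0 -[leLHS]mulr_natl.
have -> : w `^ s = w * w `^ (s - 1).
  by rewrite mulr_powRB1 ?(ltW w0) // (lt_trans ltr01).
rewrite mulrA mulfV ?gt_eqF // mul1r.
apply: (@le_trans _ _ ((c `^ (s - 1)^-1) `^ (s - 1))).
  apply: ge0_ler_powR; rewrite ?nnegrE ?powR_ge0 ?(ltW w0) //; first by lra.
  by apply: (le_trans wv); rewrite ge_min lexx orbT.
rewrite -powRrM mulVf ?powRr1 ?(ltW c0) // gt_eqF //; lra.
Qed.

(* A cover of [E] pulls back along [phi] to a cover of [0, 1[ by sets of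
   diameter at most [C * diam ^ s], whose total length is at least 1. *)
Lemma hausdorff_measure_inv_holder s (C : R) E (phi : R -> R) :
  0 <= s -> 0 < C -> (forall y, 0 <= y < 1 -> E (phi y)) ->
  (forall y z, 0 <= y < 1 -> 0 <= z < 1 -> `|y - z| <= C * `|phi y - phi z| `^ s) ->
  hausdorff_measure s E <> 0%E.
Proof.
move=> s0 C0 Ephi holder H0.
(* The intervals [J i] have total length [2 * C] times the cover sum, so this threshold keeps it at
   most 1/2. *)
have : (hausdorff_pre s 1 E < (4 * C)^-1%:E)%E.
  apply: (le_lt_trans (hausdorff_pre_le_measure s E ltr01)).
  by rewrite H0 lte_fin invr_gt0 mulr_gt0.
case/ereal_inf_lt => _ [F [EF Fd] <-] small.
pose G i := [set y : R | 0 <= y < 1 /\ F i (phi y)].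
pose r i : R := C * fine (hpow s (F i)).
(* An interval around a chosen point of [G i] is measurable whatever [G i] is; for empty [G i] the
   default centre 0 is harmless. *)
pose J i : set R := `[xget 0 (G i) - r i, xget 0 (G i) + r i]%classic.
have hfin i : hpow s (F i) = (fine (hpow s (F i)))%:E.
  by rewrite /hpow; case: asboolP.
have r0 i : 0 <= r i by rewrite mulr_ge0 ?(ltW C0) // fine_ge0 ?hpow_ge0.
have GJ i : G i `<=` J i.
  move=> y Gy; rewrite /J; case: xgetP => [x _ Gx|/(_ y) //]; rewrite /= in_itv /=.
  rewrite -ler_distl; case: Gy Gx => [y01 Fy] [x01 Fx].
  apply: (le_trans (holder _ _ y01 x01)); rewrite ler_pM2l //.
  rewrite /hpow; case: asboolP => [F0|_ /=]; first by rewrite F0 in Fy.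
  have hxy := dist_le_ediam (Fd i) Fy Fx.
  by rewrite ge0_ler_powR ?nnegrE // (le_trans _ hxy).
have cover : [set` `[0 : R, 1[] `<=` \bigcup_i J i.
  move=> y /=; rewrite in_itv /= => y01.
  have [i _ Fi] := EF _ (Ephi y y01); exists i => //.
  by apply: GJ.
have : (lebesgue_measure [set` `[0%R : R, 1%R[] <=
        \sum_(0 <= i <oo) lebesgue_measure (J i))%E.
  by apply: measure_sigma_subadditive => // i; exact: measurable_itv.
rewrite lebesgue_measure_itv /= lte_fin ltr01 oppr0 adde0.
have muJ i : lebesgue_measure (J i) = ((2 * C)%:E * hpow s (F i))%E.
  rewrite /J lebesgue_measure_itv /= lte_fin hfin -EFinM /=.
  have -> : 2 * C * fine (hpow s (F i)) = 2 * r i by rewrite /r mulrA.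
  have := r0 i; rewrite le_eqVlt => /orP[/eqP <-|ri].
    by rewrite subr0 addr0 ltxx mulr0.
  by rewrite ifT; [congr (_%:E); ring|lra].
rewrite (eq_eseriesr (fun i _ => muJ i)) nneseriesZl; last by move=> *; apply: hpow_ge0.
apply/negP; rewrite -ltNge.
apply: (@le_lt_trans _ _ ((2 * C)%:E * (4 * C)^-1%:E)%E).
  by apply: lee_wpmul2l; [rewrite lee_fin mulr_ge0 // ltW|exact: ltW].
rewrite -EFinM lte_fin ltr_pdivrMr ?mulr_gt0 // mul1r ltr_pM2r //.
lra.
Qed.

End Hausdorff.

(** * Entropies attained once and their dimension *)

Definition unique_entropy (R : realType) : set R :=
  [set q : R | 0 < q < 1 /\
       exists X : set binseq,
         ((exists S : set nat, S !=set0 /\ X = gap_shift S) /\ entropy X = q) /\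
         (forall Y : set binseq,
            ((exists S : set nat, S !=set0 /\ Y = gap_shift S) /\ entropy Y = q) ->
            Y = X)].

(** A gap shift of the same entropy has the same root [r < 1], where its series is also 1, so
    [digit_series_eq1_inj] identifies the digits. The bounds [1/2 < r < 1] put the entropy in ]0,
    1[. *)
Lemma unique_entropy_balanced (R : realType) (N : nat) (e : nat -> bool) :
  (0 < N)%N -> balanced N e -> unique_entropy (- ln (gap_root R e) / ln 2).
Proof.
move=> N0 be; have l2 := ln2_gt0 R; set r := gap_root R e.
have r0 : 0 < r := gap_root_gt0 R e.
have r1 : r < 1 := gap_root_lt1 R N0 be.
have rh : 2^-1 < r := gap_root_gt_half R N0 be.
split.
  rewrite divr_gt0 //=; last by rewrite oppr_gt0 ln_lt0 // r0.
  by rewrite ltr_pdivrMr // mul1r ltrNl -lnV ?posrE // ltr_ln ?posrE // invr_gt0.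
pose S : set nat := [set i | e i].
have dS : gap_digits S = e by apply/funext => i; rewrite /gap_digits /S /= asboolb.
exists (gap_shift S); split.
  split; first by exists S; split => //; exists 0%N; case: be => /(_ 0%N isT).
  by rewrite entropy_gap_shift dS.
move=> _ [[S' [_ ->]]]; rewrite entropy_gap_shift => h; congr gap_shift.
have rE : gap_root R (gap_digits S') = r.
  apply: ln_inj; rewrite ?posrE ?gap_root_gt0 //; apply: oppr_inj.
  by apply: (mulIf _ h); rewrite invr_eq0 gt_eqF.
have h1 := @digit_series_gap_root R e r1.
have h2 := @digit_series_gap_root R (gap_digits S'); rewrite rE in h2.
have eE := digit_series_eq1_inj be (gap_root_near_half R N0 be) (etrans h1 (esym (h2 r1))).
apply/funext => i; apply/propext; rewrite /S /= eE /gap_digits.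
by split=> [?|/asboolP//]; apply/asboolP.
Qed.

Theorem theorem4p8 (R : realType) :
  hausdorff_dim
    [set q : R | 0 < q < 1 /\
       exists X : set binseq,
         ((exists S : set nat, S !=set0 /\ X = gap_shift S) /\ entropy X = q) /\
         (forall Y : set binseq,
            ((exists S : set nat, S !=set0 /\ Y = gap_shift S) /\ entropy Y = q) ->
            Y = X)]
  = 1%:E.
Proof.
rewrite -/(@unique_entropy R); apply/eqP; rewrite eq_le; apply/andP; split.
  apply/lee_addgt0Pr => d d0; rewrite -EFinD.
  apply: ereal_inf_lbound; exists (1 + d) => //; split; first by lra.
  apply: hausdorff_measure_unit_gt1; last by lra.
  by move=> q [/andP[q0 q1] _]; rewrite /= in_itv /= !ltW.
apply: le_ereal_inf_tmp => _ [s [s0 H0] <-]; rewrite lee_fin leNgt; apply/negP => s1.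
(* Then [K * (1 - s) > 2 >= 2 * s], that is, [s * (K + 2) <= K]. *)
pose K := (Num.trunc (2 / (1 - s))).+1.
have sK : s * K.+2%:R <= K%:R.
  have /andP[_ h] := @truncn_itv R (2 / (1 - s)) ltac:(by rewrite divr_ge0 // subr_ge0 ltW).
  rewrite ltr_pdivrMr ?subr_gt0 // -/K in h.
  by rewrite -addn2 natrD; lra.
move: H0; apply: (@hausdorff_measure_inv_holder _ _ (2 ^+ (K.+4 + K.+2 + 8)) _ (@param R K)).
- by [].
- by rewrite exprn_gt0.
- by move=> y _; apply: (@unique_entropy_balanced R K.+2) => //; exact: balanced_code.
- by move=> y z y01 z01; apply: param_holder => //; rewrite s0 ltW.
Qed.
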